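(* Let $L$ be a Markov diffusion operator reversible with respect to a probability measure $\mu$, with carré du champ $\Gamma$. Assume that $\mu$ satisfies the log-Sobolev inequality $$ \mathrm{Ent}_\mu(e^f) \leq c \int e^f \Gamma(f)\, d\mu $$ for some $c \in (0,\infty)$ and any $f\in\mathcal{A}$. Then, for any $\alpha > c$ and any $f\in\mathcal{A}$ with $\int f\,d\mu=0$, the following inequality holds: $$ \log \int e^f d\mu \leq \frac{c}{\alpha -c} \int e^{\alpha |Lf|} d\mu . $$ Moreover, for such $\alpha$ and $f$, $$ \log \int e^{|f|} d\mu \leq \left( \frac{c}{e \alpha} + \log 2 + \frac{2c}{\alpha -c} \right) \int e^{\alpha |Lf|} d\mu . $$
   Context: Setting. $L$ is a Markov generator on a probability space $(\mathcal{X},\mathcal{B},\mu)$, self-adjoint in $L^2(\mu)$ (reversibility), with associated Markov semigroup $(P_t)_{t\ge0}$. One assumes the existence of a set $\mathcal{A}$ of real functions on $\mathcal{X}$ (the ''smooth enough'' functions) which is contained and dense in every $L^p(\mu)$, $1<p<\infty$, is stable under $P_t$ ($t>0$) and $L$, is stable under composition with $\mathcal{C}^\infty$ functions, contains the constants, and is such that $\lim_{t\to\infty}P_tf=\int f\,d\mu$ for all $f\in\mathcal{A}$. For $f,g\in\mathcal{A}$: $\Gamma(f,g)=\frac12\left(L(fg)-fLg-gLf\right)$, $\Gamma(f)=\Gamma(f,f)$; the integration by parts formula $\int fLg\,d\mu=-\int\Gamma(f,g)\,d\mu$ holds for $f,g\in\mathcal{A}$. $L$ is a diffusion if for every $\mathcal{C}^\infty$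 function $\Phi:\mathbb{R}^n\to\mathbb{R}$ and every $f=(f_1,\dots,f_n)\in\mathcal{A}^n$, $L(\Phi(f))=\sum_i\partial_i\Phi(f)Lf_i+\sum_{i,j}\partial^2_{ij}\Phi(f)\Gamma(f_i,f_j)$. For a non-negative function $g$, $\mathrm{Ent}_\mu(g)=\int g\log g\,d\mu-\int g\,d\mu\,\log\int g\,d\mu$. *)

(* Defs.v *)
From HB Require Import structures.
From mathcomp Require Import all_boot all_order all_algebra.
From mathcomp Require Import all_classical all_reals all_analysis.

Set Implicit Arguments.
Unset Strict Implicit.
Unset Printing Implicit Defensive.

Import Order.TTheory GRing.Theory Num.Theory.
Import numFieldNormedType.Exports.

Local Open Scope classical_set_scope.
Local Open Scope ring_scope.

(* C^k: all iterated partial derivatives of order at most k exist and are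
   continuous. *)
Fixpoint Ck (R : realType) (n k : nat) (F : 'rV[R]_n -> R) : Prop :=
  if k is k'.+1 then
    continuous F /\
    forall i : 'I_n, (forall x, derivable F x (delta_mx 0 i)) /\
      Ck k' ('D_(delta_mx 0 i) F : 'rV[R]_n -> R)
  else continuous F.

Definition Cinfty (R : realType) (n : nat) (F : 'rV[R]_n -> R) : Prop :=
  forall k, Ck k F.

Definition tuple_comp (R : realType) (X : Type) (n : nat) (F : 'rV[R]_n -> R)
    (f : 'I_n -> X -> R) : X -> R :=
  fun x => F (\row_i f i x).

(* Operators act on genuine functions; elements of L^p(mu) are represented by
   functions of [Lfun mu p], and identities between them hold mu-a.e. *)
Section MarkovOperators.
Context (d : measure_display) (X : measurableType d) (R : realType)
        (mu : probability X R).
Implicit Types (f g h : X -> R) (P : R -> (X -> R) -> X -> R)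
  (L : (X -> R) -> X -> R) (A D : set (X -> R)).

Local Notation L2 f := (f \in Lfun mu (2%:E : \bar R)).
Definition norm2 f : \bar R := 'N[mu]_(2%:E)[EFin \o f]%E.

Definition dense_in_Lp (p : R) A : Prop :=
  forall f, f \in Lfun mu p%:E -> forall e : R, 0 < e ->
    exists2 g, A g & ('N[mu]_(p%:E)[EFin \o (f \- g)%R] < e%:E)%E.

Record markov_semigroup P : Prop := MarkovSemigroup {
  semigroup_L2 : forall (t : R) f, 0 <= t -> L2 f -> L2 (P t f);
  semigroup_linear : forall (t : R) (a : R) f g, 0 <= t -> L2 f -> L2 g ->
    P t (fun x => a * f x + g x) = (fun x => a * P t f x + P t g x) %[ae mu];
  semigroup_contraction : forall (t : R) f, 0 <= t -> L2 f ->
    (norm2 (P t f) <= norm2 f)%E;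
  semigroup_0 : forall f, L2 f -> P 0 f = f %[ae mu];
  semigroup_D : forall (s t : R) f, 0 <= s -> 0 <= t -> L2 f ->
    P (s + t) f = P s (P t f) %[ae mu];
  semigroup_continuous : forall f, L2 f ->
    norm2 (P t f \- f) @[t --> 0^'+] --> 0%E;
  semigroup_ge0 : forall (t : R) f, 0 <= t -> L2 f ->
    {ae mu, forall x, 0 <= f x} -> {ae mu, forall x, 0 <= P t f x};
  semigroup_1 : forall t : R, 0 <= t -> P t (cst 1) = cst 1 %[ae mu] }.

(* h is the L^2(mu)-derivative of t |-> P_t f at t = 0^+ *)
Definition infinitesimal P f h : Prop :=
  [/\ L2 f, L2 h &
      norm2 (fun x => (P t f x - f x) / t - h x) @[t --> 0^'+] --> 0%E].

Definition generator_domain P : set (X -> R) :=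
  [set f | exists h, infinitesimal P f h].

(* The values of L outside the domain are irrelevant. *)
Definition is_generator P L : Prop :=
  forall f, generator_domain P f -> infinitesimal P f (L f).

(* The equivalence says that the adjoint of (L, D) is (L, D) itself, including
   the equality of the domains. *)
Definition self_adjoint D L : Prop :=
  dense_in_Lp 2 D /\
  forall g h, L2 g -> L2 h ->
    ((forall f, D f -> \int[mu]_x (L f x * g x) = \int[mu]_x (f x * h x))
     <-> (D g /\ L g = h %[ae mu])).

Record smooth_class P L A : Prop := SmoothClass {
  smooth_Lp : forall (p : R) f, 1 < p -> A f -> f \in Lfun mu p%:E;
  smooth_dense : forall p : R, 1 < p -> dense_in_Lp p A;
  smooth_domain : A `<=` generator_domain P;
  smooth_semigroup : forall (t : R) f, 0 < t -> A f -> A (P t f);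
  smooth_generator : forall f, A f -> A (L f);
  smooth_comp : forall n (F : 'rV[R]_n -> R) (f : 'I_n -> X -> R),
    Cinfty F -> (forall i, A (f i)) -> A (tuple_comp F f);
  smooth_cst : forall a : R, A (cst a);
  smooth_ergodic : forall f, A f ->
    norm2 (fun x => P t f x - \int[mu]_y f y) @[t --> +oo] --> 0%E }.

Definition carre_du_champ L f g : X -> R :=
  fun x => 2^-1 * (L (f \* g) x - f x * L g x - g x * L f x).

Definition diffusion L A : Prop :=
  forall n (F : 'rV[R]_n -> R) (f : 'I_n -> X -> R),
    Cinfty F -> (forall i, A (f i)) ->
    L (tuple_comp F f) =
      (fun x =>
        \sum_i tuple_comp ('D_(delta_mx 0 i) F) f x * L (f i) x +
        \sum_i \sum_j
          tuple_comp ('D_(delta_mx 0 i) ('D_(delta_mx 0 j) F)) f x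
          * carre_du_champ L (f i) (f j) x) %[ae mu].

Definition entropy g : \bar R :=
  (\int[mu]_x (g x * ln (g x))%:E
   - \int[mu]_x (g x)%:E * lne (\int[mu]_x (g x)%:E))%E.

Definition log_sobolev L A (c : R) : Prop :=
  forall f, A f ->
    (entropy (expR \o f)
     <= c%:E * \int[mu]_x (expR (f x) * carre_du_champ L f f x)%:E)%E.

End MarkovOperators.

(* Main.v *)
Require Import Defs.
From mathcomp Require Import all_boot all_order all_algebra.
From mathcomp Require Import all_classical all_reals all_analysis.
From mathcomp Require Import measurable_realfun ring lra.

(* Let Z(a) be the integral of exp(a f) and H(a) = ln Z(a) / a, so that
   H(0+) = 0.  By the diffusion property and invariance, the log-Sobolev
   inequality for a f reads Ent(exp(a f)) <= - c a \int exp(a f) Lf.  Fenchel's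
   inequality, applied to - a alpha Lf and the density exp(a f) / Z(a), bounds
   the right-hand side by (c / alpha) (Ent(exp(a f)) + a^2 M Z(a)) with
   M = \int exp(alpha |Lf|): the factor a^2 appears because Lf has mean zero.
   Hence Ent(exp(a f)) <= K a^2 Z(a) with K = c M / (alpha - c), and Herbst's
   argument gives ln Z(1) = H(1) <= K.  The bound for exp |f| follows from those
   for f and - f, since exp |f| <= exp f + exp (- f) and M >= 1. *)

Set Implicit Arguments.
Unset Strict Implicit.
Unset Printing Implicit Defensive.

Import Order.TTheory GRing.Theory Num.Theory.
Import numFieldNormedType.Exports.

Local Open Scope classical_set_scope.
Local Open Scope ring_scope.

(** * Pointwise inequalities for the exponential *)

Section ExpInequalities.
Variable R : realType.
Implicit Types u v w a b : R.

Lemma expR_tangent u v : expR v * (1 + (u - v)) <= expR u.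
Proof. by rewrite -{2}(subrKC v u) expRD ler_wpM2l ?expR_ge0 ?expR_ge1Dx. Qed.

(** Convexity: average, with weights [a] and [1 - a], the tangent at [a * v] evaluated at [v] and at
    [0]; the slope terms cancel. *)
Lemma expR_weighted_mean a v : 0 <= a <= 1 ->
  expR (a * v) <= a * expR v + (1 - a).
Proof.
move=> /andP[a0 a1].
have := expR_tangent v (a * v); have := expR_tangent 0 (a * v).
rewrite expR0 => h0 h1.
have := ler_wpM2l a0 h1; have /ler_wpM2l/(_ _ _ h0) : 0 <= 1 - a by lra.
by move=> *; lra.
Qed.

(** The difference [h] has derivative at least [a ^+ 2], by [a] times the weighted mean inequality,
    so [h v >= h 0 = a ^+ 2 - 1]. *)
Lemma expR_quadratic_ge0 a v : 0 <= a <= 1 -> 0 <= v ->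
  expR (a * v) <= 1 + a * v + a ^+ 2 * expR v.
Proof.
move=> /[dup] a01 /andP[a0 a1] v0.
pose h := fun y : R => a ^+ 2 * expR y - (expR (a * y) - a * y).
pose h' := fun y : R => a ^+ 2 * expR y - (a * expR (a * y) - a).
have dh (y : R) : is_derive y 1 h (h' y).
  by apply: is_derive_eq; rewrite /h' /GRing.scale/=; ring.
have : h 0 <= h v.
  apply: (@ger0_derive1_ndecry _ h 0) => //.
  - move=> x _; rewrite derive1E derive_val /h'.
    have := ler_wpM2l a0 (expR_weighted_mean x a01).
    by have := sqr_ge0 a; lra.
  - apply: continuous_subspaceT => x.
    by apply/differentiable_continuous/derivable1_diffP; have [] := dh x.
by rewrite /h !mulr0 expR0; have := sqr_ge0 a; lra.
Qed.

Lemma expR_quadratic_le0 a v : 0 <= a <= 1 -> 0 <= v ->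
  expR (- (a * v)) <= 1 - a * v + a ^+ 2 * expR v.
Proof.
move=> /andP[a0 a1] v0.
pose h := fun y : R => a ^+ 2 * expR y - (expR (- (a * y)) + a * y).
pose h' := fun y : R => a ^+ 2 * expR y - (a - a * expR (- (a * y))).
have dh (y : R) : is_derive y 1 h (h' y).
  by apply: is_derive_eq; rewrite /h' /GRing.scale/=; ring.
have : h 0 <= h v.
  apply: (@ger0_derive1_ndecry _ h 0) => //.
  - move=> x _; rewrite derive1E derive_val /h'.
    (* The terms linear in [x] of these two bounds cancel, leaving [h' x >= a ^+ 2]. *)
    have := ler_wpM2l a0 (expR_ge1Dx (- (a * x))).
    have := ler_wpM2l (sqr_ge0 a) (expR_ge1Dx x).
    by have := sqr_ge0 a; lra.
  - apply: continuous_subspaceT => x.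
    by apply/differentiable_continuous/derivable1_diffP; have [] := dh x.
by rewrite /h !mulr0 oppr0 expR0; have := sqr_ge0 a; lra.
Qed.

(** Source of the factor [a ^+ 2]: for a centred variable the linear term integrates to zero. *)
Lemma expR_quadratic a v : 0 <= a <= 1 ->
  expR (a * v) <= 1 + a * v + a ^+ 2 * expR `|v|.
Proof.
move=> a01; have [v0|v0] := ger0P v; first exact: expR_quadratic_ge0.
have := @expR_quadratic_le0 a (- v) a01.
by rewrite mulrN !opprK; apply; rewrite oppr_ge0 ltW.
Qed.

(* Fenchel's inequality for the conjugate pair [exp w] and [t * ln t - t],
   at [t = exp w]. *)
Lemma expR_fenchel w v : expR w * v <= w * expR w - expR w + expR v.
Proof. by have := expR_tangent v w; lra. Qed.

Lemma expR_norm_le u : expR `|u| <= expR u + expR (- u).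
Proof.
have [_|_] := ger0P u; first by rewrite lerDl expR_ge0.
by rewrite lerDr expR_ge0.
Qed.

(** Bounds a product by pure exponentials, to dominate [g * expR (a * f)]: use
    [|u| <= expR u + expR (- u)], then bound each product of two exponentials by the sum of their
    squares. *)
Lemma norm_mulr_expR_le u v :
  `|u * expR v| <= expR (2 * u) + expR (- 2 * u) + expR (2 * v).
Proof.
rewrite normrM (ger0_norm (expR_ge0 _)).
have hu : `|u| <= expR u + expR (- u).
  by apply: le_trans (expR_norm_le u); have := expR_ge1Dx `|u|; lra.
have -> : - 2 * u = - u + - u by ring.
rewrite !mulr_natl !mulr2n !expRD.
apply: (le_trans (ler_wpM2r (expR_ge0 v) hu)).
have := sqr_ge0 (expR u - expR v); have := sqr_ge0 (expR (- u) - expR v).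
rewrite !expr2; nra.
Qed.

End ExpInequalities.

(** * Exponential moments, tilted means and Herbst's argument *)

Section Expectation.
Context (d : measure_display) (X : measurableType d) (R : realType)
        (mu : probability X R).
Implicit Types (f g h : X -> R) (a b u v : R).

(** Integrability travels with the value, so that linear combinations and comparisons of means carry
    their own side conditions. *)
Definition has_mean h u :=
  mu.-integrable setT (EFin \o h) /\ \int[mu]_x h x = u.

Lemma has_mean_Rintegral h : mu.-integrable setT (EFin \o h) ->
  has_mean h (\int[mu]_x h x).
Proof. by []. Qed.

Lemma has_mean_integral h u : has_mean h u -> (\int[mu]_x (h x)%:E = u%:E)%E.
Proof.
by case=> ih <-; rewrite /Rintegral fineK// integrable_fin_num.
Qed.

Lemma has_mean_cst a : has_mean (fun=> a) a.
Proof.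
split; first exact: finite_measure_integrable_cst.
rewrite Rintegral_cst// (_ : fine _ = 1) ?mulr1//.
by rewrite [X in fine X]probability_setT.
Qed.

Lemma has_meanD f g u v : has_mean f u -> has_mean g v ->
  has_mean (fun x => f x + g x) (u + v).
Proof.
move=> [fi <-] [gi <-]; split; last by rewrite RintegralD.
exact: (@eq_integrable _ _ _ _ _ _ _ _ _ (integrableD _ fi gi)).
Qed.

Lemma has_meanZ f u a : has_mean f u -> has_mean (fun x => a * f x) (a * u).
Proof.
move=> [fi <-]; split; last by rewrite RintegralZl.
exact: (@eq_integrable _ _ _ _ _ _ _ _ _ (integrableZl _ a fi)).
Qed.

Lemma has_mean_le f g u v : has_mean f u -> has_mean g v ->
  (forall x, f x <= g x) -> u <= v.
Proof. by move=> [fi <-] [gi <-] fg; apply: le_Rintegral. Qed.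

Definition exp_integrable f := measurable_fun setT f /\
  forall a, mu.-integrable setT (EFin \o (fun x => expR (a * f x))).

Definition mgf f a := \int[mu]_x expR (a * f x).

Lemma has_mean_mgf f a : exp_integrable f ->
  has_mean (fun x => expR (a * f x)) (mgf f a).
Proof. by move=> [_ fi]; apply: has_mean_Rintegral. Qed.

Lemma integrable_le f g : measurable_fun setT f ->
  mu.-integrable setT (EFin \o g) -> (forall x, `|f x| <= g x) ->
  mu.-integrable setT (EFin \o f).
Proof.
move=> mf gi fg; apply: le_integrable gi => //.
  exact/measurable_EFinP.
by move=> x _; rewrite /= lee_fin (le_trans (fg x))// ler_norm.
Qed.

Lemma integrable_mulr_expR f g a : exp_integrable f -> exp_integrable g ->
  mu.-integrable setT (EFin \o (fun x => g x * expR (a * f x))).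
Proof.
move=> ef eg; have [[mf _] [mg _]] := (ef, eg).
have [hi _] := has_meanD (has_meanD (has_mean_mgf 2 eg) (has_mean_mgf (- 2) eg))
  (has_mean_mgf (2 * a) ef).
apply: (integrable_le _ hi) => [|x]; last first.
  by rewrite -mulrA; exact: norm_mulr_expR_le.
apply: measurable_funM => //; apply: measurableT_comp => //.
exact: measurable_funM.
Qed.

Lemma exp_integrable_integrable f : exp_integrable f ->
  mu.-integrable setT (EFin \o f).
Proof.
move=> ef; apply: eq_integrable (integrable_mulr_expR 0 ef ef) => //.
by move=> x _; rewrite /= mul0r expR0 mulr1.
Qed.

Lemma integrable_expR_norm f a : 0 <= a -> exp_integrable f ->
  mu.-integrable setT (EFin \o (fun x => expR (a * `|f x|))).
Proof.
move=> a0 ef; have [mf _] := ef.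
have [hi _] := has_meanD (has_mean_mgf a ef) (has_mean_mgf (- a) ef).
apply: (integrable_le _ hi) => [|x].
  by apply: measurableT_comp => //; apply: measurable_funM => //;
    exact: measurableT_comp.
rewrite ger0_norm ?expR_ge0// -(ger0_norm a0) -normrM (ger0_norm a0) mulNr.
exact: expR_norm_le.
Qed.

(** Integrate [1 + u <= expR u]. This also supplies the positivity needed to take logarithms. *)
Lemma mgf_ge1 f a : exp_integrable f -> \int[mu]_x f x = 0 -> 1 <= mgf f a.
Proof.
move=> ef f0; have hf := has_mean_Rintegral (exp_integrable_integrable ef).
have h := has_meanD (has_mean_cst 1) (has_meanZ a hf).
rewrite f0 mulr0 addr0 in h.
by apply: (has_mean_le h (has_mean_mgf a ef)) => x; exact: expR_ge1Dx.
Qed.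

Lemma mgf_quadratic f a b : exp_integrable f -> \int[mu]_x f x = 0 ->
  0 <= a <= 1 ->
  mgf f (a * b) <= 1 + a ^+ 2 * \int[mu]_x expR (`|b| * `|f x|).
Proof.
move=> ef f0 a01.
have hf := has_mean_Rintegral (exp_integrable_integrable ef).
have hn := has_mean_Rintegral (integrable_expR_norm (normr_ge0 b) ef).
have h := has_meanD (has_meanD (has_mean_cst 1) (has_meanZ (a * b) hf))
  (has_meanZ (a ^+ 2) hn).
rewrite f0 mulr0 addr0 in h.
apply: (has_mean_le (has_mean_mgf (a * b) ef) h) => x.
by rewrite -normrM -(mulrA a b (f x)); exact: expR_quadratic.
Qed.

(** Formally the derivative of [mgf f] at [a]; it is not normalised by [mgf f a]. *)
Definition tilted_mean f a := \int[mu]_x (f x * expR (a * f x)).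

Lemma has_mean_tilted f a : exp_integrable f ->
  has_mean (fun x => f x * expR (a * f x)) (tilted_mean f a).
Proof. by move=> ef; apply/has_mean_Rintegral/integrable_mulr_expR. Qed.

(* Jensen's inequality for [exp] under the measure with density
   [expR (b * f) / mgf f b]. *)
Lemma ln_mgf_tangent f a b : exp_integrable f -> \int[mu]_x f x = 0 ->
  ln (mgf f b) + (a - b) * (tilted_mean f b / mgf f b) <= ln (mgf f a).
Proof.
move=> ef f0; set Z := mgf f b; set m := tilted_mean f b / Z.
have Z0 : 0 < Z by exact: lt_le_trans (mgf_ge1 _ ef f0).
have Za0 : 0 < mgf f a by exact: lt_le_trans (mgf_ge1 _ ef f0).
(* Integrand of the tangent at [(a - b) * m], weighted by [expR (b * f)]; its mean is
   [Z * expR ((a - b) * m)] because [m] is the tilted average of [f]. *)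
have h := has_meanZ (expR ((a - b) * m))
  (has_meanD (has_meanZ (1 - (a - b) * m) (has_mean_mgf b ef))
     (has_meanZ (a - b) (has_mean_tilted b ef))).
have le : Z * expR ((a - b) * m) <= mgf f a.
  apply: le_trans (has_mean_le h (has_mean_mgf a ef) _).
    rewrite mulrC ler_wpM2l ?expR_ge0// -/Z.
    have -> : tilted_mean f b = m * Z by rewrite /m divfK ?gt_eqF.
    by rewrite le_eqVlt; apply/orP; left; apply/eqP; ring.
  move=> x.
  have -> : a * f x = b * f x + (a - b) * f x by ring.
  rewrite [leRHS]expRD.
  have := ler_wpM2l (expR_ge0 (b * f x))
    (expR_tangent ((a - b) * f x) ((a - b) * m)).
  by lra.
rewrite -[(a - b) * m]expRK -lnM ?posrE ?expR_gt0//.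
by rewrite ler_ln ?posrE ?mulr_gt0 ?expR_gt0.
Qed.

(* Herbst's argument without differentiation under the integral: the tangent
   inequality bounds the increments of [ln (mgf f a) / a]. *)
Lemma herbst_step f K a b : exp_integrable f -> \int[mu]_x f x = 0 ->
  0 < a -> a <= b ->
  b * tilted_mean f b - mgf f b * ln (mgf f b) <= K * b ^+ 2 * mgf f b ->
  ln (mgf f b) / b <= ln (mgf f a) / a + K * (b / a) * (b - a).
Proof.
move=> ef f0 a0 ab; set Z := mgf f b => ent.
have Z0 : 0 < Z by exact: lt_le_trans (mgf_ge1 _ ef f0).
have b0 : 0 < b by exact: lt_le_trans ab.
have := ln_mgf_tangent a b ef f0; rewrite -/Z.
set m := tilted_mean f b / Z; set la := ln (mgf f a); set lb := ln Z.
have em : tilted_mean f b = m * Z by rewrite /m divfK ?gt_eqF.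
have entm : b * m - lb <= K * b ^+ 2.
  by rewrite -(ler_pM2r Z0); move: ent; rewrite em -/lb; lra.
move=> tangent.
(* With denominators cleared, the claim is [b] times [tangent] plus [b - a] times [entm]; the terms
   in [m] cancel. *)
rewrite -(ler_pM2r (mulr_gt0 a0 b0)).
have -> : lb / b * (a * b) = lb * a by field; rewrite gt_eqF.
have -> : (la / a + K * (b / a) * (b - a)) * (a * b)
    = la * b + K * b ^+ 2 * (b - a) by field; rewrite gt_eqF.
have ba : 0 <= b - a by lra.
have := ler_wpM2l ba entm; have := ler_wpM2l (ltW b0) tangent; lra.
Qed.

Lemma herbst f K : exp_integrable f -> \int[mu]_x f x = 0 -> 0 <= K ->
  (forall a, 0 < a <= 1 ->
    a * tilted_mean f a - mgf f a * ln (mgf f a) <= K * a ^+ 2 * mgf f a) ->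
  ln (mgf f 1) <= K.
Proof.
(* Sum the increments along a = q ^ n, let n tend to infinity, then q to 1. *)
move=> ef f0 K0 ent; set H := ln (mgf f 1).
have geom (q : R) : 0 < q < 1 -> q * H <= K.
  move=> /andP[q0 q1]; have qn0 := exprn_gt0 _ q0.
  (* The increment from [q ^+ n.+1] to [q ^+ n] costs [K / q * (q ^+ n - q ^+ n.+1)], which
     telescopes. *)
  have step n : H <= ln (mgf f (q ^+ n)) / q ^+ n + K / q * (1 - q ^+ n).
    elim: n => [|n ih]; first by rewrite expr0 divr1 subrr mulr0 addr0.
    apply: le_trans ih _.
    have qn1 : q ^+ n <= 1 by rewrite exprn_ile1 ?ltW.
    have qnS : q ^+ n.+1 <= q ^+ n by rewrite exprS ler_piMl ?ltW.
    have qn01 : 0 < q ^+ n <= 1 by rewrite qn0.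
    have := herbst_step ef f0 (qn0 n.+1) qnS (ent _ qn01).
    have -> : q ^+ n / q ^+ n.+1 = q^-1.
      by rewrite exprS invfM mulrCA divff ?mulr1// gt_eqF.
    by lra.
  pose B := \int[mu]_x expR (1 * `|f x|).
  (* From [ln z <= z - 1] and the quadratic bound on [mgf]: the first term of [step] vanishes in the
     limit. *)
  have small n : ln (mgf f (q ^+ n)) / q ^+ n <= q ^+ n * B.
    have qn1 : q ^+ n <= 1 by rewrite exprn_ile1 ?ltW.
    have := @mgf_quadratic f (q ^+ n) 1 ef f0.
    rewrite mulr1 normr1 ltW//= => /(_ qn1) le.
    rewrite ler_pdivrMr// mulrAC -expr2.
    have := @le_ln1Dx R (mgf f (q ^+ n) - 1).
    have := mgf_ge1 (q ^+ n) ef f0.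
    rewrite -/B in le.
    by rewrite subrKC => Z1 /(_ _); lra.
  have bound n : q * H - K <= q ^+ n * (q * B - K).
    have := step n; have := small n; have := ltW q0 => h1 h2 h3.
    have := ler_wpM2l h1 (le_trans h3 (lerD h2 (lexx _))).
    have -> : q * (q ^+ n * B + K / q * (1 - q ^+ n))
      = q ^+ n * (q * B - K) + K by field; rewrite gt_eqF.
    by lra.
  rewrite -subr_le0.
  have cv : q ^+ n * (q * B - K) @[n --> \oo] --> (0 : R).
    rewrite -[X in _ --> X](mul0r (q * B - K)).
    by apply: cvgMr_tmp; apply: cvg_expr; rewrite ger0_norm ?ltW.
  rewrite -(cvg_lim (@Rhausdorff R) cv); apply: limr_ge; last exact: nearW.
  by apply/cvg_ex; exists 0.
rewrite leNgt; apply/negP => KH.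
have H0 : 0 < H by exact: le_lt_trans KH.
(* If [K < H], this [q] lies in []0, 1[] and [q * H] is the midpoint of [K] and [H], which exceeds
   [K]. *)
have := geom ((K + H) / (2 * H)).
have -> : (K + H) / (2 * H) * H = (K + H) / 2 by field; rewrite gt_eqF.
rewrite divr_gt0 ?mulr_gt0 ?ltr_wpDl//= ltr_pdivrMr ?mulr_gt0// => /(_ _); lra.
Qed.

(** Fenchel's inequality at [w = a * f - ln Z], [v = - (a * b) * g], multiplied by [Z] and
    integrated. The [1] in the quadratic bound on [mgf g (- (a * b))] cancels the term
    [- expR w]. *)
Lemma entropy_duality f g a b : exp_integrable f -> exp_integrable g ->
    \int[mu]_x f x = 0 -> \int[mu]_x g x = 0 -> 0 <= a <= 1 -> 0 <= b ->
  - (a * b) * \int[mu]_x (g x * expR (a * f x)) <=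
  a * tilted_mean f a - mgf f a * ln (mgf f a)
    + a ^+ 2 * mgf f a * \int[mu]_x expR (b * `|g x|).
Proof.
move=> ef eg f0 g0 a01 b0; set Z := mgf f a.
have Z0 : 0 < Z by exact: lt_le_trans (mgf_ge1 _ ef f0).
have hgf := has_mean_Rintegral (integrable_mulr_expR a ef eg).
have hl := has_meanZ (- (a * b)) hgf.
have hr := has_meanD (has_meanD (has_meanZ a (has_mean_tilted a ef))
  (has_meanZ (- (1 + ln Z)) (has_mean_mgf a ef)))
  (has_meanZ Z (has_mean_mgf (- (a * b)) eg)).
have := has_mean_le hl hr; rewrite -/Z.
have : mgf g (- (a * b)) <= 1 + a ^+ 2 * \int[mu]_x expR (b * `|g x|).
  by have := mgf_quadratic (- b) eg g0 a01; rewrite mulrN normrN (ger0_norm b0).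
move=> /(ler_wpM2l (ltW Z0)) quad /(_ _) dual.
apply: le_trans (dual _) _; last by lra.
move=> x; have := expR_fenchel (a * f x - ln Z) (- (a * b) * g x).
rewrite expRD expRN lnK ?posrE// => /(ler_wpM2l (ltW Z0)).
set e := expR (a * f x).
have -> : Z * (e / Z * (- (a * b) * g x)) = - (a * b) * (g x * e).
  by field; rewrite gt_eqF.
move=> /le_trans -> //.
rewrite le_eqVlt; apply/orP; left; apply/eqP.
by field; rewrite gt_eqF.
Qed.

End Expectation.

(** * Smoothness of polynomials times exponentials *)

Section SmoothFunctions.
Variable R : realType.

(** A class closed under partial derivatives lets the induction on the order run over all its
    members at once. *)
Lemma Cinfty_coind n (S : set ('rV[R]_n -> R)) :
  (forall F, S F -> continuous F /\ forall i : 'I_n,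
     (forall x, derivable F x (delta_mx 0 i)) /\ S ('D_(delta_mx 0 i) F)) ->
  forall F, S F -> Cinfty F.
Proof.
move=> hS F SF k; elim: k F SF => [|k ih] F SF /=;
  have [cF dF] := hS _ SF => //.
by split=> // i; have [dFi SFi] := dF i; split=> //; apply: ih.
Qed.

(** Presents a function of one variable in the form required by [smooth_comp] and [diffusion] at
    [n = 1]. *)
Definition coord1 (phi : R -> R) : 'rV[R]_1 -> R := fun x => phi (x 0 0).

Lemma is_derive_coord1 (phi : R -> R) (x : 'rV[R]_1) (i : 'I_1) :
  derivable phi (x 0 0) 1 ->
  is_derive x (delta_mx 0 i) (coord1 phi) (phi^`()%classic (x 0 0)).
Proof.
move=> dphi.
have cvg_dq :
    h^-1 *: ((coord1 phi \o shift x) (h *: delta_mx 0 i) - coord1 phi x) @[h --> 0^'] --> phi^`()%classic (x 0 0).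
  rewrite derive1E.
  rewrite (_ : (fun h : R => _) = (fun h : R =>
      h^-1 *: ((phi \o shift (x 0 0)) (h *: 1) - phi (x 0 0)))); last first.
    by apply/funext => h; rewrite /coord1/= !mxE [i]ord1 !eqxx.
  exact: dphi.
apply: DeriveDef; first by apply/cvg_ex; eexists; exact: cvg_dq.
exact: cvg_lim cvg_dq.
Qed.

Lemma Cinfty_coord1 (S : set (R -> R)) :
  (forall phi, S phi -> (forall x, derivable phi x 1) /\ S (phi^`()%classic)) ->
  forall phi, S phi -> Cinfty (coord1 phi).
Proof.
move=> hS phi Sphi.
apply: (@Cinfty_coind 1 [set coord1 phi | phi in S]); last by exists phi.
move=> _ [psi Spsi <-]; have [dpsi Spsi'] := hS _ Spsi; split.
  move=> x; apply: (@continuous_comp _ _ _ (fun y : 'rV[R]_1 => y 0 0)).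
    exact: coord_continuous.
  by apply/differentiable_continuous/derivable1_diffP.
move=> i; split=> [x|].
  by have [] := is_derive_coord1 i (dpsi (x 0 0)).
exists (psi^`()%classic) => //; apply/funext => x.
by have [_ ->] := is_derive_coord1 i (dpsi (x 0 0)).
Qed.

(** A family closed under differentiation that contains constants, scalings, the square and the
    exponentials, hence every composition used below. *)
Definition poly_expR (p : {poly R}) (b : R) : R -> R :=
  fun x => p.[x] * expR (b * x).

Lemma is_derive_poly_expR p b (x : R) :
  is_derive x 1 (poly_expR p b) (poly_expR (p^`() + b *: p) b x).
Proof.
have dp : is_derive x 1 (horner p) (p^`()).[x].
  apply: DeriveDef; first exact: derivable_horner.
  by rewrite derivE derive1E.
apply: is_derive_eq.
by rewrite /poly_expR !hornerE /GRing.scale/=; ring.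
Qed.

Lemma derive1_poly_expR p b :
  (poly_expR p b)^`()%classic = poly_expR (p^`() + b *: p) b.
Proof.
apply/funext => x; rewrite derive1E.
by have [_ ->] := is_derive_poly_expR p b x.
Qed.

Lemma Cinfty_poly_expR p b : Cinfty (coord1 (poly_expR p b)).
Proof.
apply: (@Cinfty_coord1 [set poly_expR q b | q in setT]); last by exists p.
move=> _ [q _ <-]; split; last by rewrite derive1_poly_expR; eexists.
by move=> x; have [] := is_derive_poly_expR q b x.
Qed.

Lemma derive_coord1_poly_expR p b (i : 'I_1) :
  'D_(delta_mx 0 i) (coord1 (poly_expR p b)) =
  coord1 (poly_expR (p^`() + b *: p) b).
Proof.
apply/funext => x; have [dp _] := is_derive_poly_expR p b (x 0 0).
by have [_ ->] := is_derive_coord1 i dp; rewrite derive1_poly_expR.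
Qed.

End SmoothFunctions.

(** * Consequences of the diffusion property and of the log-Sobolev inequality *)

Section DiffusionOperators.
Context (R : realType) (d : measure_display) (X : measurableType d)
    (mu : probability X R) (P : R -> (X -> R) -> X -> R)
    (L : (X -> R) -> X -> R) (A : set (X -> R)).
Hypotheses (reversibleL : self_adjoint mu (generator_domain mu P) L)
    (smoothA : smooth_class mu P L A)
    (diffusionL : diffusion mu L A).

Local Notation Gamma := (carre_du_champ L).

Lemma smooth_L2 f : A f -> f \in Lfun mu (2%:E : \bar R).
Proof. by move=> Af; apply: (smooth_Lp smoothA) => //; rewrite ltr1n. Qed.

Lemma smooth_integrable f : A f -> mu.-integrable setT (EFin \o f).
Proof.
move=> /smooth_L2 f2; apply/Lfun1_integrable.
by apply: Lfun_subset12 f2; exact: fin_num_measure.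
Qed.

Lemma smooth_measurable f : A f -> measurable_fun setT f.
Proof. by move=> /smooth_integrable/measurable_int/measurable_EFinP. Qed.

Lemma tuple_comp_coord1 phi f :
  tuple_comp (@coord1 R phi) (fun=> f) = phi \o f :> (X -> R).
Proof. by apply/funext => x; rewrite /tuple_comp /coord1 mxE. Qed.

Lemma smooth_poly_expR p b f : A f -> A (poly_expR p b \o f).
Proof.
move=> Af; rewrite -tuple_comp_coord1.
exact: (smooth_comp smoothA (Cinfty_poly_expR p b)).
Qed.

Lemma diffusion_poly_expR p b f : A f ->
  let p1 := p^`() + b *: p in let p2 := p1^`() + b *: p1 in
  L (poly_expR p b \o f) =
    (fun x => poly_expR p1 b (f x) * L f x
              + poly_expR p2 b (f x) * Gamma f f x) %[ae mu].
Proof.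
move=> Af /=; rewrite -tuple_comp_coord1.
have := diffusionL (Cinfty_poly_expR p b) (fun=> Af).
apply: filterS => x /(_ I) + _ => ->.
by rewrite !big_ord1 !derive_coord1_poly_expR !tuple_comp_coord1.
Qed.

Lemma smooth_expR a f : A f -> A (fun x => expR (a * f x)).
Proof.
move=> /(smooth_poly_expR 1 a); congr (A _); apply/funext => x.
by rewrite /poly_expR/= hornerC mul1r.
Qed.

Lemma smooth_exp_integrable f : A f -> exp_integrable mu f.
Proof.
move=> Af; split; first exact: smooth_measurable.
by move=> a; apply/smooth_integrable/smooth_expR.
Qed.

Lemma smoothZ a f : A f -> A (fun x => a * f x).
Proof.
move=> /(smooth_poly_expR (a *: 'X) 0); congr (A _); apply/funext => x.
by rewrite /poly_expR/= !hornerE expR0 mulr1.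
Qed.

(** Makes [L (f \* f)], and so [Gamma f f], measurable. *)
Lemma smooth_sqr f : A f -> A (f \* f).
Proof.
move=> /(smooth_poly_expR 'X^2 0); congr (A _); apply/funext => x.
by rewrite /poly_expR/= !hornerE expR0 mulr1.
Qed.

(** The diffusion formula for [x |-> a * x], whose second derivative vanishes. *)
Lemma generatorZ a f : A f ->
  L (fun x => a * f x) = (fun x => a * L f x) %[ae mu].
Proof.
move=> /(diffusion_poly_expR (a *: 'X) 0)/=.
have -> : poly_expR (a *: 'X) 0 \o f = (fun x => a * f x).
  by apply/funext => x; rewrite /poly_expR/= !hornerE expR0 mulr1.
apply: filterS => x /(_ I) + _ => ->.
rewrite /poly_expR derivZ derivX !scale0r !addr0 alg_polyC derivC.
by rewrite hornerC horner0 !mul0r expR0 mulr1 addr0.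
Qed.

Lemma generator_cst : L (cst 1) = cst 0 %[ae mu].
Proof.
have A0 := smooth_cst smoothA 0.
have := diffusion_poly_expR 1 0 A0 => /=.
have -> : poly_expR 1 0 \o cst 0 = cst 1 :> (X -> R).
  by apply/funext => x; rewrite /poly_expR/= hornerC mul0r expR0 mulr1.
apply: filterS => x /(_ I) + _ => ->.
by rewrite /poly_expR derivC !scale0r !addr0 deriv0 hornerC !mul0r addr0.
Qed.

(** Invariance of [mu]: test self-adjointness against [cst 1], which lies in the domain and is
    killed by [L]. *)
Lemma generator_mean0 f : A f -> \int[mu]_x L f x = 0.
Proof.
move=> Af; have A1 := smooth_cst smoothA 1; have A0 := smooth_cst smoothA 0.
have [_ adj] := reversibleL.
have [_] := adj (cst 1) (cst 0) (smooth_L2 A1) (smooth_L2 A0).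
move=> /(_ _ _ (smooth_domain smoothA Af)).
under eq_Rintegral do rewrite /= mulr1.
under [in RHS]eq_Rintegral do rewrite /= mulr0.
rewrite Rintegral_cst// mul0r; apply; split; last exact: generator_cst.
exact: (smooth_domain smoothA).
Qed.

(** The diffusion formula gives [L (expR f) = expR f * (L f + Gamma f f)] almost everywhere, and the
    left side has mean zero. *)
Lemma integral_expR_carre_du_champ f : A f ->
  (\int[mu]_x (expR (f x) * Gamma f f x)%:E
   = (- \int[mu]_x (L f x * expR (f x)))%:E)%E.
Proof.
move=> Af; have ALf := smooth_generator smoothA Af.
have Ae : A (expR \o f).
  have := smooth_expR 1 Af; congr (A _); apply/funext => x; by rewrite mul1r.
have ALe := smooth_generator smoothA Ae.
have Lfe := integrable_mulr_expR 1 (smooth_exp_integrable Af)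
  (smooth_exp_integrable ALf).
have hm := has_meanD (has_mean_Rintegral (smooth_integrable ALe))
  (has_meanZ (- 1) (has_mean_Rintegral Lfe)).
rewrite generator_mean0// add0r mulN1r in hm.
under [in RHS]eq_Rintegral do rewrite -[f _]mul1r.
rewrite -(has_mean_integral hm); apply: ae_eq_integral => //.
- apply/measurable_EFinP; apply: measurable_funM.
    exact: smooth_measurable.
  apply: measurable_funM => //.
  apply: measurable_funB; first apply: measurable_funB.
  + by apply/smooth_measurable/(smooth_generator smoothA)/smooth_sqr.
  + by apply: measurable_funM; exact: smooth_measurable.
  + by apply: measurable_funM; exact: smooth_measurable.
- by case: hm => /measurable_int.
have := diffusion_poly_expR 1 1 Af => /=.
have -> : poly_expR 1 1 \o f = expR \o f.
  by apply/funext => x; rewrite /poly_expR/= hornerC !mul1r.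
apply: filterS => x /(_ I) + _ => ->.
rewrite derivC !scale1r !add0r derivC add0r.
by rewrite /poly_expR hornerC !mul1r; congr EFin; ring.
Qed.

(** The log-Sobolev inequality for [a * f]: the left side is the entropy of [expR (a * f)]. *)
Lemma log_sobolev_mgf c f a : log_sobolev mu L A c -> A f ->
    \int[mu]_x f x = 0 ->
  a * tilted_mean mu f a - mgf mu f a * ln (mgf mu f a) <=
  - (c * a * \int[mu]_x (L f x * expR (a * f x))).
Proof.
move=> lsi Af f0; pose h x := a * f x; have Ah : A h := smoothZ a Af.
have ef := smooth_exp_integrable Af.
have eLf := smooth_exp_integrable (smooth_generator smoothA Af).
have eLh := smooth_exp_integrable (smooth_generator smoothA Ah).
have Lh : \int[mu]_x (L h x * expR (h x)) =
    a * \int[mu]_x (L f x * expR (a * f x)).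
  rewrite -RintegralZl//; last exact: integrable_mulr_expR.
  congr fine; apply: ae_eq_integral => //.
  - apply/measurable_EFinP; apply: measurable_funM.
      exact/smooth_measurable/(smooth_generator smoothA).
    exact/smooth_measurable/smooth_expR.
  - apply/measurable_EFinP; apply: measurable_funM => //.
    by have /measurable_int/measurable_EFinP := integrable_mulr_expR a ef eLf.
  have := generatorZ a Af.
  by apply: filterS => x /(_ I) + _ => ->; rewrite mulrA.
have := lsi h Ah; rewrite integral_expR_carre_du_champ// Lh /entropy.
have Z0 : 0 < mgf mu f a by exact: lt_le_trans (mgf_ge1 _ ef f0).
rewrite (has_mean_integral (has_mean_mgf a ef)) lne_EFin//.
under eq_integral do rewrite /= expRK.
have := has_meanZ a (has_mean_tilted a ef).
under [X in has_mean _ X]eq_fun do rewrite mulrA mulrC.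
move=> /has_mean_integral ->.
by rewrite -!EFinM -EFinB lee_fin mulrN mulrA.
Qed.

Lemma ln_mgf_le c alpha f : 0 < c -> c < alpha -> log_sobolev mu L A c ->
    A f -> \int[mu]_x f x = 0 ->
  ln (mgf mu f 1) <= c / (alpha - c) * \int[mu]_x expR (alpha * `|L f x|).
Proof.
move=> c0 calpha lsi Af f0; set M := \int[mu]_x expR _.
have alpha0 : 0 < alpha by exact: lt_trans calpha.
have M0 : 0 <= M by apply: Rintegral_ge0 => x _; exact: expR_ge0.
have ef := smooth_exp_integrable Af.
have eLf := smooth_exp_integrable (smooth_generator smoothA Af).
have ac0 : 0 < alpha - c by rewrite subr_gt0.
apply: (herbst ef f0) => [|a /andP[a0 a1]].
  by rewrite mulr_ge0// divr_ge0// ltW.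
have a01 : 0 <= a <= 1 by rewrite ltW.
have := entropy_duality ef eLf f0 (generator_mean0 Af) a01 (ltW alpha0).
have := log_sobolev_mgf a lsi Af f0; rewrite -/M.
set E := a * _ - _; set I := \int[mu]_x (_ * _) => lsia dual.
(* Weights [alpha] and [c] eliminate the integral [I], leaving the entropy [E] with coefficient
   [alpha - c > 0]. *)
have := ler_wpM2l (ltW c0) dual; have := ler_wpM2l (ltW alpha0) lsia.
move=> h1 h2; have h : (alpha - c) * E <= c * (a ^+ 2 * mgf mu f a * M) by lra.
rewrite -(ler_pM2l ac0); apply: le_trans h _.
by rewrite le_eqVlt; apply/orP; left; apply/eqP; field; rewrite gt_eqF.
Qed.

(** Lets one constant serve both [f] and its opposite; [L] commutes with the sign only almost
    everywhere. *)
Lemma mean_expR_norm_generatorN alpha f : A f ->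
  \int[mu]_x expR (alpha * `|L (fun x => -1 * f x) x|) =
  \int[mu]_x expR (alpha * `|L f x|).
Proof.
move=> Af; congr fine; apply: ae_eq_integral => //.
- apply/measurable_EFinP/measurableT_comp => //; apply: measurable_funM => //.
  apply: measurableT_comp => //.
  exact/smooth_measurable/(smooth_generator smoothA)/smoothZ.
- apply/measurable_EFinP/measurableT_comp => //; apply: measurable_funM => //.
  apply: measurableT_comp => //.
  exact/smooth_measurable/(smooth_generator smoothA).
have := generatorZ (-1) Af.
by apply: filterS => x /(_ I) + _ => ->; rewrite mulN1r normrN.
Qed.

End DiffusionOperators.

(** * The two exponential bounds *)

Theorem theorem3p9 (R : realType) (d : measure_display) (X : measurableType d)
    (mu : probability X R) (P : R -> (X -> R) -> X -> R)
    (L : (X -> R) -> X -> R) (A : set (X -> R))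
    (markovP : markov_semigroup mu P)
    (genL : is_generator mu P L)
    (reversibleL : self_adjoint mu (generator_domain mu P) L)
    (smoothA : smooth_class mu P L A)
    (diffusionL : diffusion mu L A)
    (c : R) (c_gt0 : 0 < c) (logSobolev : log_sobolev mu L A c)
    (alpha : R) (alpha_gt : c < alpha)
    (f : X -> R) (Af : A f) (f_mean0 : (\int[mu]_x (f x)%:E = 0)%E) :
  (lne (\int[mu]_x (expR (f x))%:E)
     <= (c / (alpha - c))%:E * \int[mu]_x (expR (alpha * `|L f x|))%:E)%E
  /\
  (lne (\int[mu]_x (expR `|f x|)%:E)
     <= (c / (expR 1 * alpha) + ln 2 + 2 * c / (alpha - c))%:E
        * \int[mu]_x (expR (alpha * `|L f x|))%:E)%E.
Proof.
have f0 : \int[mu]_x f x = 0 by rewrite /Rintegral f_mean0.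
have alpha0 : 0 < alpha by exact: lt_trans alpha_gt.
have ac0 : 0 < alpha - c by rewrite subr_gt0.
have ef := smooth_exp_integrable smoothA Af.
have eLf := smooth_exp_integrable smoothA (smooth_generator smoothA Af).
pose g x := -1 * f x; have Ag : A g := smoothZ smoothA (-1) Af.
have eg := smooth_exp_integrable smoothA Ag.
have g0 : \int[mu]_x g x = 0.
  by rewrite RintegralZl ?f0 ?mulr0//; exact: exp_integrable_integrable.
have hM := has_mean_Rintegral (integrable_expR_norm (ltW alpha0) eLf).
rewrite (has_mean_integral hM).
set M := \int[mu]_x expR _ in hM *.
have M1 : 1 <= M.
  apply: (has_mean_le (has_mean_cst mu 1) hM) => x.
  by rewrite -[leLHS]expR0 ler_expR mulr_ge0// ltW.
have le := ln_mgf_le reversibleL smoothA diffusionL c_gt0 alpha_gt logSobolev.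
have lef := le _ Af f0; have leg := le _ Ag g0.
rewrite (mean_expR_norm_generatorN smoothA diffusionL)// in leg.
rewrite -/M in lef leg; set k := c / (alpha - c) in lef leg *.
have Zf0 : 0 < mgf mu f 1 by exact: lt_le_trans (mgf_ge1 _ ef f0).
have Zg0 : 0 < mgf mu g 1 by exact: lt_le_trans (mgf_ge1 _ eg g0).
split.
  under eq_integral do rewrite -[f _]mul1r.
  by rewrite (has_mean_integral (has_mean_mgf 1 ef)) lne_EFin// -EFinM lee_fin.
have hN := has_mean_Rintegral (integrable_expR_norm ler01 ef).
under eq_integral do rewrite -[`|f _|]mul1r.
rewrite (has_mean_integral hN); set N := \int[mu]_x _ in hN *.
have N1 : 1 <= N.
  apply: (has_mean_le (has_mean_cst mu 1) hN) => x.
  by rewrite -[leLHS]expR0 ler_expR mul1r.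
have N0 : 0 < N by exact: lt_le_trans N1.
rewrite lne_EFin// -EFinM lee_fin.
have NZ : N <= mgf mu f 1 + mgf mu g 1.
  apply: (has_mean_le hN (has_meanD (has_mean_mgf 1 ef) (has_mean_mgf 1 eg))).
  by move=> x; rewrite /g /= !mul1r mulN1r; exact: expR_norm_le.
have leexp z : 0 < z -> ln z <= k * M -> z <= expR (k * M).
  by move=> z0; rewrite -[in X in _ -> X](lnK z0) ler_expR.
have lnN : ln N <= ln 2 + k * M.
  rewrite -[k * M]expRK -lnM ?posrE ?expR_gt0//.
  rewrite ler_ln ?posrE ?mulr_gt0 ?expR_gt0//.
  by have := leexp _ Zf0 lef; have := leexp _ Zg0 leg; lra.
apply: le_trans lnN _.
have k0 : 0 < k by rewrite divr_gt0.
have l2 : 0 <= ln 2 :> R by rewrite ln_ge0// ler1n.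
have c1 : 0 <= c / (expR 1 * alpha).
  by rewrite divr_ge0 ?mulr_ge0 ?expR_ge0// ltW.
have -> : 2 * c / (alpha - c) = 2 * k by rewrite /k mulrA.
have M0 : 0 <= M by lra.
(* Since [M >= 1], [ln 2] is at most [ln 2 * M]; also [k * M <= 2 * k * M], and the remaining term
   is nonnegative. *)
have := ler_wpM2l l2 M1; have := mulr_ge0 (ltW k0) M0; have := mulr_ge0 c1 M0.
by lra.
Qed.
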